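(* Let $\Delta$ be a simplicial complex on a finite vertex set $V$, and let $\Delta^\vee=\{V\setminus F: F\subseteq V,\ F\notin\Delta\}$ be its Alexander dual (a simplicial complex on $V$). Then $\Delta$ satisfies the spectral recursion if and only if $\Delta^\vee$ satisfies the spectral recursion.
   Context: A simplicial complex $\Delta$ on a finite vertex set $V$ is a collection of subsets of $V$ (faces) closed under taking subsets. The empty set is a face (of dimension $-1$) of every complex that has at least one face; the empty complex $\emptyset$ (no faces at all) is allowed; an element $v\in V$ need not satisfy $\{v\}\in\Delta$. Put $\dim F=|F|-1$. A simplicial pair $(\Delta,\Delta')$ consists of two simplicial complexes on the same vertex set; pairs with the same set difference $\Delta\setminus\Delta'$ are identified, and a single complex $\Delta$ is the pair $(\Delta,\emptyset)$. For $i\ge -1$, $C_i(\Delta,\Delta';\mathbb R)$ is the real vector space of formal linear combinations of oriented $i$-dimensional faces $[F]$, $F\in\Delta\setminus\Delta'$, and $\partial_i\colon C_i\to C_{i-1}$ is the usual signed simplicial boundary operator with all terms outside $\Delta\setminus\Delta'$ dropped; $\partial_i^*$ is its adjoint (transposed matrix in the natural bases). The Laplacian is $L_i(\Delta,\Delta')=\partial_{i+1}\partial_{i+1}^*+\partial_i^*\partial_i$, and $\mathbf s_i(\Delta,\Delta')$ is the multiset of its eigenvalues (non-negative reals). The spectrum polynomial is the generating function $$S_{(\Delta,\Delta')}(t,q)=\sum_{i\ge 0}t^i\sum_{\lambda\in\mathbf s_{i-1}(\Delta,\Delta')}q^\lambda,\qquad S_\Delta=S_{(\Delta,\emptyset)}$$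 (exponents of $q$ may be arbitrary non-negative reals). For $e\in V$, the deletion $\Delta-e=\{F\in\Delta: e\notin F\}$ and the contraction $\Delta/e=\{F\setminus\{e\}: F\in\Delta,\ e\in F\}$ are simplicial complexes on vertex set $V\setminus\{e\}$. $\Delta$ satisfies the spectral recursion with respect to $e\in V$ if $$S_\Delta(t,q) = q\,S_{\Delta-e}(t,q) + qt\,S_{\Delta/e}(t,q) + (1-q)\,S_{(\Delta-e,\Delta/e)}(t,q),$$ and $\Delta$ satisfies the spectral recursion if this holds for every $e\in V$. *)

(* Defs.v *)
From HB Require Import structures.
From mathcomp Require Import all_boot all_order all_algebra.
From mathcomp Require Import polyrcf.
From mathcomp Require Import monalg.
From mathcomp Require Import reals.

Set Implicit Arguments.
Unset Strict Implicit.
Unset Printing Implicit Defensive.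

Import Order.TTheory GRing.Theory Num.Theory.

Local Open Scope ring_scope.

(* A complex may be empty (no face at all), and a vertex of V need not be a
   face.  The ground set V is a subset of an ambient finite type T, so that
   deletions and contractions live on V :\ e. *)
Record simplicial_complex (T : finType) (V : {set T}) := SimplicialComplex {
  faces :> {set {set T}};
  faces_ground : faces \subset powerset V;
  faces_closed : forall F G : {set T}, F \in faces -> G \subset F -> G \in faces
}.

Section Complexes.
Variables (T : finType) (V : {set T}).
Implicit Types (D : simplicial_complex V) (e : T).

Fact empty_ground : (set0 : {set {set T}}) \subset powerset V.
Proof. exact: sub0set. Qed.

Fact empty_closed (F G : {set T}) :
  F \in (set0 : {set {set T}}) -> G \subset F -> G \in (set0 : {set {set T}}).
Proof. by rewrite inE. Qed.

Definition empty_complex : simplicial_complex V :=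
  SimplicialComplex empty_ground empty_closed.

Definition deletion_faces D e : {set {set T}} := [set F in faces D | e \notin F].

Fact deletion_ground D e : deletion_faces D e \subset powerset (V :\ e).
Proof.
apply/subsetP=> F; rewrite !inE => /andP[FD eF].
by rewrite subsetD1 eF andbT -powersetE (subsetP (faces_ground D)).
Qed.

Fact deletion_closed D e (F G : {set T}) :
  F \in deletion_faces D e -> G \subset F -> G \in deletion_faces D e.
Proof.
rewrite !inE => /andP[FD eF] GF; rewrite (faces_closed FD GF) /=.
by apply: contra eF => /(subsetP GF).
Qed.

Definition deletion D e : simplicial_complex (V :\ e) :=
  SimplicialComplex (deletion_ground D e) (@deletion_closed D e).

Definition contraction_faces D e : {set {set T}} :=
  [set F :\ e | F in [set F in faces D | e \in F]].

Fact contraction_ground D e : contraction_faces D e \subset powerset (V :\ e).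
Proof.
apply/subsetP=> _ /imsetP[F /[!inE] /andP[FD _] ->].
by rewrite setSD // -powersetE (subsetP (faces_ground D)).
Qed.

Fact contraction_closed D e (F G : {set T}) :
  F \in contraction_faces D e -> G \subset F -> G \in contraction_faces D e.
Proof.
move=> /imsetP[H /[!inE] /andP[HD eH] ->]; rewrite subsetD1 => /andP[GH eG].
apply/imsetP; exists (e |: G); last by rewrite setU1K.
by rewrite !inE eqxx andbT; apply: faces_closed HD _; rewrite subUset sub1set eH.
Qed.

Definition contraction D e : simplicial_complex (V :\ e) :=
  SimplicialComplex (contraction_ground D e) (@contraction_closed D e).

Definition dual_faces D : {set {set T}} :=
  [set V :\: F | F in [set F in powerset V | F \notin faces D]].

Fact dual_ground D : dual_faces D \subset powerset V.
Proof.
by apply/subsetP=> _ /imsetP[F _ ->]; rewrite powersetE subsetDl.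
Qed.

Fact dual_closed D (F G : {set T}) :
  F \in dual_faces D -> G \subset F -> G \in dual_faces D.
Proof.
move=> /imsetP[H /[!inE] /andP[HV HD] ->] GH.
have GV : G \subset V by apply: subset_trans GH (subsetDl _ _).
apply/imsetP; exists (V :\: G); last by rewrite setDDr setDv set0U (setIidPr GV).
rewrite !inE subsetDl; apply: contra HD => /faces_closed; apply.
rewrite subsetD HV; rewrite subsetD disjoint_sym in GH.
by case/andP: GH.
Qed.

Definition alexander_dual D : simplicial_complex V :=
  SimplicialComplex (dual_ground D) (@dual_closed D).

End Complexes.

Arguments empty_complex {T V}.

Definition face_dim (T : finType) (F : {set T}) : int := #|F|%:Z - 1.

Section Laplacian.
Variables (R : rcfType) (T : finType).

(* Coefficient of [G] in the boundary of [F], when F = {x_0 < ... < x_k} is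
   oriented by the enumeration order of T: the sum has at most one term, which
   is (-1)^j if G = F \ {x_j}. *)
Definition incidence (G F : {set T}) : R :=
  \sum_(x in F | F :\ x == G)
    (-1) ^+ #|[set y in F | (enum_rank y < enum_rank x)%N]|.

(* The boundary map from chains on B to chains on A, as a matrix acting on
   column vectors; the terms outside A are dropped. *)
Definition boundary_mx (A B : {set {set T}}) : 'M[R]_(#|A|, #|B|) :=
  \matrix_(i, j) incidence (enum_val i) (enum_val j).

Variable V : {set T}.
Implicit Types (D E : simplicial_complex V) (i : int).

Definition pair_faces D E i : {set {set T}} :=
  [set F in faces D :\: faces E | face_dim F == i].

(* boundary D E i is the map from i-chains to (i - 1)-chains; it is stated
   with independent degrees i, j because i + 1 - 1 is not convertible to i. *)
Definition boundary D E i j :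
    'M[R]_(#|pair_faces D E j|, #|pair_faces D E i|) :=
  boundary_mx (pair_faces D E j) (pair_faces D E i).

Definition laplacian D E i : 'M[R]_#|pair_faces D E i| :=
  boundary D E (i + 1) i *m (boundary D E (i + 1) i)^T
  + (boundary D E i (i - 1))^T *m boundary D E i (i - 1).

(* The roots in R of the characteristic polynomial, listed with their
   multiplicities; all roots are real for a symmetric matrix. *)
Definition eigenvalues n (A : 'M[R]_n) : seq R :=
  flatten [seq nseq (mup x (char_poly A)) x | x <- rootsR (char_poly A)].

Definition spectrum D E i : seq R := eigenvalues (laplacian D E i).

Lemma spectrum_ge0 D E i x : x \in spectrum D E i -> 0 <= x.
Proof.
case/flatten_mapP=> y yr; rewrite mem_nseq => /andP[_ /eqP ->] {x}.
have p0 : char_poly (laplacian D E i) != 0.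
  by rewrite monic_neq0 ?char_poly_monic.
have root_y : root (char_poly (laplacian D E i)) y.
  by have := roots_on_rootsR p0 y; rewrite yr => /andP[].
move: root_y; rewrite -eigenvalue_root_char => /eigenvalueP[v vL v0].
have dot_ge0 n (w : 'rV[R]_n) : 0 <= (w *m w^T) 0 0.
  by rewrite mxE sumr_ge0 // => k _; rewrite !mxE -expr2 sqr_ge0.
have dot_gt0 : 0 < (v *m v^T) 0 0.
  rewrite lt_neqAle dot_ge0 andbT eq_sym; apply: contra v0 => /eqP.
  rewrite mxE => /psumr_eq0P h; apply/eqP/rowP=> k; rewrite mxE.
  apply/eqP; rewrite -sqrf_eq0 expr2; have := h _ k isT.
  by rewrite !mxE => -> // l _; rewrite !mxE -expr2 sqr_ge0.
rewrite -(pmulr_lge0 _ dot_gt0).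
have -> : y * (v *m v^T) 0 0 = (v *m laplacian D E i *m v^T) 0 0.
  by rewrite vL -scalemxAl [in RHS]mxE.
rewrite /laplacian mulmxDr mulmxDl mxE addr_ge0 //.
  have := dot_ge0 _ (v *m boundary D E (i + 1) i).
  by rewrite trmx_mul !mulmxA.
have := dot_ge0 _ (v *m (boundary D E i (i - 1))^T).
by rewrite trmx_mul trmxK !mulmxA.
Qed.

End Laplacian.

(* The additive monoid of non-negative reals, written multiplicatively as the
   monoid of the monomials q^x. *)
Record qmonom (R : realDomainType) := QMonom {
  qexp : R;
  qexp_ge0 : 0 <= qexp
}.

Section QMonom.
Variable R : realDomainType.

HB.instance Definition _ := [isSub for @qexp R].
HB.instance Definition _ := [Choice of qmonom R by <:].

Implicit Types a b c : qmonom R.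

Definition qmonom1 : qmonom R := QMonom (lexx 0).

Definition qmonomM a b : qmonom R :=
  QMonom (addr_ge0 (qexp_ge0 a) (qexp_ge0 b)).

Fact qmonomMA : associative qmonomM.
Proof. by move=> a b c; apply: val_inj; rewrite /= addrA. Qed.

Fact qmonom1M : left_id qmonom1 qmonomM.
Proof. by move=> a; apply: val_inj; rewrite /= add0r. Qed.

Fact qmonomM1 : right_id qmonom1 qmonomM.
Proof. by move=> a; apply: val_inj; rewrite /= addr0. Qed.

Fact qmonom_unit a b :
  qmonomM a b = qmonom1 -> a = qmonom1 /\ b = qmonom1.
Proof.
move=> /(congr1 val) /= /eqP; rewrite paddr_eq0 ?qexp_ge0 //.
by move=> /andP[/eqP a0 /eqP b0]; split; apply: val_inj.
Qed.

Fact qmonomMC : commutative qmonomM.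
Proof. by move=> a b; apply: val_inj; rewrite /= addrC. Qed.

HB.instance Definition _ := Choice_isMonomialDef.Build (qmonom R)
  qmonomMA qmonom1M qmonomM1 qmonom_unit.
HB.instance Definition _ := MonomialDef_isConomialDef.Build (qmonom R) qmonomMC.

End QMonom.

(* Finite integer combinations of the monomials t^i q^x with i a natural number
   and x a non-negative real: polynomials in t over the algebra of the q^x. *)
Definition tq_algebra (R : realDomainType) := {poly {malg int[qmonom R]}}.

HB.instance Definition _ (R : realDomainType) :=
  GRing.ComNzRing.on (tq_algebra R).

Section SpectralRecursion.
Variable R : realType.

(* q^x is meaningful for 0 <= x only (it is 1 otherwise); by spectrum_ge0 it is
   never used outside this range. *)
Definition qpow (x : R) : tq_algebra R :=
  (<< insubd (qmonom1 R) x >> : {malg int[qmonom R]})%:P.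

Definition q_var : tq_algebra R := qpow 1.
Definition t_var : tq_algebra R := 'X.

(* No face has more than #|V| elements, so the sum over i stops at #|V|. *)
Definition spectrum_poly (T : finType) (V : {set T})
    (D E : simplicial_complex V) : tq_algebra R :=
  \sum_(i < #|V|.+1)
    t_var ^+ i * \sum_(x <- spectrum R D E (i%:Z - 1)) qpow x.

Definition spectral_recursion_at (T : finType) (V : {set T})
    (D : simplicial_complex V) (e : T) : Prop :=
  spectrum_poly D empty_complex =
    q_var * spectrum_poly (deletion D e) empty_complex
    + q_var * t_var * spectrum_poly (contraction D e) empty_complex
    + (1 - q_var) * spectrum_poly (deletion D e) (contraction D e).

Definition spectral_recursion (T : finType) (V : {set T})
    (D : simplicial_complex V) : Prop :=
  forall e : T, e \in V -> spectral_recursion_at D e.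

End SpectralRecursion.

(* Main.v *)
Require Import Defs.
From mathcomp Require Import all_boot all_order all_algebra.
From mathcomp Require Import reals.
From mathcomp Require Import polyrcf monalg zify ring.

(* Write n = |V|.  On the full simplex the Laplacian is n times the identity.
   If X is the block of the simplicial boundary going from the non-faces of D of
   dimension i + 1 to the faces of dimension i, then the Laplacians of D and of
   the pair (2^V, D) in degrees i and i + 1 are n - X X^T and n - X^T X, so their
   spectra agree up to copies of the eigenvalue n.  Taking complements in V turns
   the boundary into its transpose up to signs, hence the pair (D, E) in degree i
   has the spectrum of its dual pair in degree n - i - 2.  Together these express
   the spectrum of the Alexander dual in degree i through that of D in degree
   n - i - 3.  Deletion and contraction are exchanged by duality, and the
   discrepancies, all multiples of q^n, cancel in the recursion because each face
   either avoids or contains e. *)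

Set Implicit Arguments.
Unset Strict Implicit.
Unset Printing Implicit Defensive.

Import Order.TTheory GRing.Theory Num.Theory.

Local Open Scope ring_scope.

(** * Characteristic polynomials and sums over eigenvalues *)

Section SharedSpectrum.

(* Both sides are factorizations of the determinant of the block matrix
   [[y, X], [Y, 1]], obtained by clearing either off-diagonal block. *)
Lemma det_scalar_sub_mulC (A : comNzRingType) m n (y : A)
    (X : 'M[A]_(m, n)) (Y : 'M[A]_(n, m)) :
  \det (y%:M - X *m Y) * y ^+ n = \det (y%:M - Y *m X) * y ^+ m.
Proof.
set M := block_mx y%:M X Y 1%:M.
have left_det : \det (y%:M - X *m Y) = \det M.
  have := det_lblock (1%:M : 'M[A]_m) (- Y) 1%:M; rewrite !det1 mulr1 => det_low.
  rewrite -[RHS]mulr1 -det_low -det_mulmx mulmx_block !mulmx1 !mulmx0 !add0r.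
  by rewrite mulmxN mul1mx addrN det_ublock det1 mulr1.
rewrite left_det mulrC -det_scalar.
have := det_lblock 1%:M (- Y) (y%:M : 'M_n); rewrite det1 mul1r => <- .
rewrite -det_mulmx mulmx_block !mul1mx !mul0mx !addr0 mulmx1 mulNmx.
rewrite mul_mx_scalar mul_scalar_mx addNr det_ublock det_scalar mulrC.
by rewrite mulNmx addrC.
Qed.

(** This is the determinant identity over polynomials with y = 'X - c; since 'X - (c - U W) = y + U
    W, the sign is absorbed into the left factor. *)
Lemma char_poly_sub_mulC (A : comNzRingType) m n (c : A)
    (X : 'M[A]_(m, n)) (Y : 'M[A]_(n, m)) :
  char_poly (c%:M - X *m Y) * ('X - c%:P) ^+ n =
  char_poly (c%:M - Y *m X) * ('X - c%:P) ^+ m.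
Proof.
have cp k l (U : 'M_(k, l)) (W : 'M_(l, k)) : char_poly (c%:M - U *m W) =
    \det (('X - c%:P)%:M - map_mx polyC (- U) *m map_mx polyC W).
  rewrite /char_poly /char_poly_mx map_mxB map_mxM map_scalar_mx.
  by rewrite map_mxN mulNmx opprB opprK (raddfB (@scalar_mx _ _)) /= addrA addrAC.
rewrite !cp det_scalar_sub_mulC; congr (\det (_ - _) * _).
by rewrite !map_mxN mulNmx mulmxN.
Qed.

Variables (R : rcfType) (Z : nmodType) (g : R -> Z).

(** The weight [g] is arbitrary, later q^x. Depending only on [p], this sum turns identities between
    products of characteristic polynomials into relations between spectra. *)
Definition root_sum (p : {poly R}) : Z :=
  \sum_(x <- rootsR p) g x *+ mup x p.

Lemma sum_eigenvalues n (A : 'M[R]_n) :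
  \sum_(x <- eigenvalues A) g x = root_sum (char_poly A).
Proof.
rewrite /eigenvalues big_flatten /= big_map; apply: eq_bigr => x _.
by rewrite big_nseq; elim: (mup _ _) => //= k ->; rewrite mulrS.
Qed.

(** Non-roots have multiplicity 0, so several polynomials can be summed over one common list of
    points. *)
Lemma root_sum_wide p s : p != 0 -> uniq s -> {subset rootsR p <= s} ->
  root_sum p = \sum_(x <- s) g x *+ mup x p.
Proof.
move=> p0 us sub; rewrite /root_sum [RHS](bigID (mem (rootsR p))) /=.
rewrite [X in _ = _ + X]big1 ?addr0.
  rewrite -[RHS]big_filter; apply/perm_big/uniq_perm; rewrite ?filter_uniq //.
    by rewrite /rootsR uniq_roots.
  move=> x; rewrite mem_filter; case xr: (x \in rootsR p) => //=.
  by rewrite (sub _ xr).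
move=> x; have := roots_on_rootsR p0 x; rewrite inE /= => <- px.
by rewrite mupNroot ?mulr0n.
Qed.

Lemma root_sumM p q : p != 0 -> q != 0 ->
  root_sum (p * q) = root_sum p + root_sum q.
Proof.
move=> p0 q0; pose s := undup (rootsR p ++ rootsR q).
have us : uniq s by rewrite undup_uniq.
have pq0 : p * q != 0 by rewrite mulf_neq0.
have mem_rootsR r x : r != 0 -> (x \in rootsR r) = root r x.
  by move=> r0; have := roots_on_rootsR r0 x; rewrite inE /= => <-.
rewrite !(@root_sum_wide _ s) //.
- by rewrite -big_split; apply: eq_bigr => x _; rewrite mupM // mulrnDr.
- by move=> x xq; rewrite mem_undup mem_cat xq orbT.
- by move=> x xp; rewrite mem_undup mem_cat xp.
by move=> x; rewrite mem_undup mem_cat !mem_rootsR // rootM.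
Qed.

Lemma root_sum_XsubC c n : root_sum (('X - c%:P) ^+ n) = g c *+ n.
Proof.
have c0 : ('X - c%:P) ^+ n != 0 by rewrite expf_neq0 ?polyXsubC_eq0.
rewrite (@root_sum_wide _ [:: c]) //; last first.
  move=> x; have := roots_on_rootsR c0 x; rewrite inE /= => <-.
  rewrite inE; case: n {c0} => [|n]; first by rewrite expr0 rootC oner_eq0.
  by rewrite root_exp_XsubC.
by rewrite big_seq1 mup_XsubCX eqxx.
Qed.

(** The factors ('X - c)^n and ('X - c)^m of [char_poly_sub_mulC] become the extra copies of [g c],
    kept on both sides because [Z] has no subtraction. *)
Lemma sum_eigenvalues_gram m n (c : R) (X : 'M[R]_(m, n)) :
  \sum_(x <- eigenvalues (c%:M - X *m X^T)) g x + g c *+ n =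
  \sum_(x <- eigenvalues (c%:M - X^T *m X)) g x + g c *+ m.
Proof.
have cp0 k (A : 'M[R]_k) : char_poly A != 0 by rewrite monic_neq0 ?char_poly_monic.
have c0 k : ('X - c%:P) ^+ k != 0 by rewrite expf_neq0 ?polyXsubC_eq0.
rewrite !sum_eigenvalues -(root_sum_XsubC c n) -(root_sum_XsubC c m).
rewrite -(root_sumM (cp0 _ _) (c0 n)) -(root_sumM (cp0 _ _) (c0 m)).
by rewrite char_poly_sub_mulC.
Qed.

(** Invariance under orthogonal conjugation when the two sizes are equal but not convertible:
    [char_poly_sub_mulC] at c = 0 for the factors - S B and S^T, after which 'X^n cancels. *)
Lemma char_poly_isometry m n (A : 'M[R]_m) (B : 'M[R]_n) (S : 'M[R]_(m, n)) :
  m = n -> S^T *m S = 1%:M -> A = S *m B *m S^T -> char_poly A = char_poly B.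
Proof.
move=> mn SS ->.
have := char_poly_sub_mulC 0 (- (S *m B)) S^T.
rewrite mulmxN mulNmx mulmxA SS mul1mx !(raddf0 (@scalar_mx R _)) !sub0r !opprK.
rewrite [in X in _ = X -> _]mn.
have X0 : ('X - (0 : R)%:P) ^+ n != 0 by rewrite expf_neq0 ?polyXsubC_eq0.
exact: (mulIf X0).
Qed.

End SharedSpectrum.

(** * Incidence signs and the Laplacian of the full simplex *)

Section Incidence.
Variables (R : rcfType) (T : finType).
Implicit Types (x y : T) (F G H V : {set T}) (N P : {set {set T}}) (i : int).

Definition nb_lower x F : nat := \sum_(y in F) (enum_rank y < enum_rank x)%N.

Definition vertex_sign x F : R := (-1) ^+ nb_lower x F.

Lemma nb_lowerU1 x y F :
  y \notin F -> nb_lower x (y |: F) = ((enum_rank y < enum_rank x) + nb_lower x F)%N.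
Proof. by move=> yF; rewrite /nb_lower big_setU1. Qed.

Lemma nb_lowerD1 x y F :
  y \in F -> nb_lower x F = ((enum_rank y < enum_rank x) + nb_lower x (F :\ y))%N.
Proof. by move=> yF; rewrite /nb_lower (big_setD1 y). Qed.

(** A vertex never counts itself, so adding x and removing it again carry the same sign. *)
Lemma nb_lowerU1_same x F : nb_lower x (x |: F) = nb_lower x F.
Proof.
case xF: (x \in F); first by rewrite (setUidPr _) // sub1set.
by rewrite nb_lowerU1 ?xF // ltnn.
Qed.

Lemma incidenceE G F :
  incidence R G F = \sum_(x in F | F :\ x == G) vertex_sign x F.
Proof.
apply: eq_bigr => x _; congr (_ ^+ _); rewrite -sum1_card /nb_lower.
rewrite big_mkcond [RHS]big_mkcond; apply: eq_bigr => y _; rewrite inE.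
by case: (y \in F) => //=; case: ltnP.
Qed.

Lemma incidence_nsub G F : ~~ (G \subset F) -> incidence R G F = 0.
Proof.
move=> nGF; rewrite incidenceE big1 // => x /andP[_ /eqP GF].
by rewrite -GF subD1set in nGF.
Qed.

Lemma incidence_dim G F :
  face_dim F != face_dim G + 1 -> incidence R G F = 0.
Proof.
move=> dFG; rewrite incidenceE big1 // => x /andP[xF /eqP GF].
case/eqP: dFG; rewrite /face_dim -GF (cardsD1 x F) xF; lia.
Qed.

Lemma sum_coboundary V F (f : {set T} -> R) : F \subset V ->
  \sum_(H in powerset V) incidence R F H * f H =
  \sum_(x in V :\: F) vertex_sign x F * f (x |: F).
Proof.
move=> FV; under eq_bigr => H _ do rewrite incidenceE mulr_suml.
rewrite (exchange_big_dep (mem (V :\: F))) /=; last first.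
  move=> H x; rewrite powersetE => /subsetP HV /andP[xH /eqP <-].
  by rewrite !inE eqxx HV.
apply: eq_bigr => x /[!inE] /andP[xF xV].
rewrite (big_pred1 (x |: F)) => [|H].
  by rewrite /vertex_sign nb_lowerU1_same.
rewrite powersetE; apply/idP/eqP=> [/and3P[_ xH /eqP <-]|->].
  by rewrite setD1K.
by rewrite subUset sub1set xV FV setU11 setU1K /=.
Qed.

Lemma sum_boundary V F (f : {set T} -> R) : F \subset V ->
  \sum_(H in powerset V) incidence R H F * f H =
  \sum_(x in F) vertex_sign x F * f (F :\ x).
Proof.
move=> FV; under eq_bigr => H _ do rewrite incidenceE mulr_suml.
rewrite (exchange_big_dep (mem F)) /=; last by move=> H x _ /andP[].
apply: eq_bigr => x xF; rewrite (big_pred1 (F :\ x)) // => H.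
rewrite powersetE xF /= eq_sym; case: eqP => [->|]; rewrite ?andbF //.
by rewrite (subset_trans (subD1set _ _) FV).
Qed.

(** The sums run over all of [N], since incidences vanish between faces in non-consecutive
    dimensions. This makes the coefficient additive in [N]. *)
Definition laplacian_coef N F G : R :=
  \sum_(H in N) incidence R F H * incidence R G H
  + \sum_(H in N) incidence R H F * incidence R H G.

(* Removing y after adding x and adding x after removing y lead to the same
   face with opposite signs, so only the terms with x = y survive. *)
Lemma laplacian_coef_simplex V F G : F \subset V -> G \subset V ->
  laplacian_coef (powerset V) F G = #|V|%:R *+ (F == G).
Proof.
move=> FV GV; rewrite /laplacian_coef sum_coboundary // sum_boundary //.
(* [c] describes going from F to G by adding x, then removing y; [d] describes removing y, then
   adding x. *)
pose c x y := (x \notin F) && ((y \in x |: F) && ((x |: F) :\ y == G)).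
pose d x y := (y \in F) && ((x \in G) && (G :\ x == F :\ y)).
pose u x y : R := if c x y then vertex_sign x F * vertex_sign y (x |: F) else 0.
pose v x y : R := if d x y then vertex_sign y F * vertex_sign x G else 0.
have -> : \sum_(x in V :\: F) vertex_sign x F * incidence R G (x |: F) =
          \sum_(x in V) \sum_(y in V) u x y.
  rewrite big_mkcond [RHS]big_mkcond; apply: eq_bigr => x _.
  rewrite inE; case xV: (x \in V); last by rewrite andbF.
  rewrite andbT /u /c; case: (x \notin F) => /=; last by rewrite big1.
  rewrite incidenceE mulr_sumr big_mkcond [RHS]big_mkcond.
  apply: eq_bigr => y _; case yV: (y \in V) => //.
  rewrite ifF //; apply: contraFF yV => /andP[yF _].
  by apply: subsetP yF; rewrite subUset sub1set xV.
have -> : \sum_(y in F) vertex_sign y F * incidence R (F :\ y) G =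
          \sum_(x in V) \sum_(y in V) v x y.
  rewrite exchange_big big_mkcond [RHS]big_mkcond; apply: eq_bigr => y _.
  rewrite /v /d; case yF: (y \in F); last by rewrite big1 ?if_same.
  rewrite (subsetP FV) // incidenceE mulr_sumr big_mkcond [RHS]big_mkcond.
  apply: eq_bigr => x _; case xV: (x \in V) => //.
  by rewrite ifF //; apply: contraFF xV => /andP[/(subsetP GV)].
rewrite -big_split -sum1_card natr_sum -sumrMnl; apply: eq_bigr => x xV.
(* On the diagonal y = x, each x in V contributes 1 when F = G, through the upper sum if x is
   outside F and through the lower one otherwise. *)
rewrite -big_split (bigD1 x) //= big1 ?addr0 => [|y /andP[_ yx]].
  rewrite /u /v /c /d setU11 /=; case xF: (x \in F) => /=.
    have [<-|FG] := eqVneq F G.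
      by rewrite xF eqxx add0r -expr2 -exprM mulnC exprM sqrrN !expr1n.
    rewrite ifF ?addr0 //; apply: contra_neqF FG => /andP[xG /eqP GF].
    by rewrite -(setD1K xG) GF setD1K.
  rewrite addr0 setU1K ?xF //; case: eqVneq => // _.
  by rewrite /vertex_sign nb_lowerU1_same -expr2 -exprM mulnC exprM sqrrN !expr1n.
have cd : c x y = d x y.
  rewrite /c /d !inE (negPf yx) /=; apply/and3P/and3P=> [[xF yF /eqP <-]|].
    rewrite yF !inE eqxx eq_sym yx; split=> //.
    apply/eqP/setP=> z; rewrite !inE; case: eqVneq => //= ->.
    by rewrite (negPf xF) andbF.
  move=> [yF xG /eqP GF]; have xF : x \notin F.
    have := setD11 x G; rewrite GF !inE eq_sym yx /= => ->; by [].
  split=> //; apply/eqP/setP=> z; rewrite -(setD1K xG) GF !inE.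
  by case: (eqVneq z x) => [->|] //=; rewrite eq_sym yx.
rewrite /u /v -cd; case: ifP => [/and3P[xF yxF /eqP <-]|_]; last by rewrite addr0.
have yF : y \in F by move: yxF; rewrite !inE (negPf yx).
have -> : (x |: F) :\ y = x |: (F :\ y).
  by apply/setP=> z; rewrite !inE; case: (eqVneq z x) => [->|] //=; rewrite eq_sym yx.
rewrite /vertex_sign nb_lowerU1_same nb_lowerU1 // (nb_lowerD1 x yF) -!exprD.
(* The two exponents differ by the number of true comparisons among x < y and y < x, which is
   exactly one. *)
have rxy : enum_rank x != enum_rank y :> nat.
  by apply: contra_neq yx => /val_inj/enum_rank_inj.
case: (ltngtP (enum_rank x) (enum_rank y)) rxy => //= _ _.
  by rewrite !add0n addnCA exprS mulN1r addnC addNr.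
by rewrite !add0n addnAC -addnA exprS mulN1r addnC addNr.
Qed.

End Incidence.

(** * Laplacians of arbitrary families of faces *)

Section Families.
Variables (R : rcfType) (T : finType).
Implicit Types (F G H V : {set T}) (N M P : {set {set T}}) (i : int).

Definition layer N i : {set {set T}} := [set F in N | face_dim F == i].

Definition family_laplacian P N : 'M[R]_#|P| :=
  \matrix_(i, j) laplacian_coef R N (enum_val i) (enum_val j).

Lemma sum_layer_up N i F (f : {set T} -> R) : face_dim F = i ->
  \sum_(H in layer N (i + 1)) incidence R F H * f H =
  \sum_(H in N) incidence R F H * f H.
Proof.
move=> dF; rewrite big_mkcond [RHS]big_mkcond; apply: eq_bigr => H _.
rewrite inE; case: (H \in N) => //=; case: eqP => // /eqP dH.
by rewrite incidence_dim ?mul0r ?dF.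
Qed.

Lemma sum_layer_down N i F (f : {set T} -> R) : face_dim F = i ->
  \sum_(H in layer N (i - 1)) incidence R H F * f H =
  \sum_(H in N) incidence R H F * f H.
Proof.
move=> dF; rewrite big_mkcond [RHS]big_mkcond; apply: eq_bigr => H _.
rewrite inE; case: (H \in N) => //=; case: eqP => // /eqP dH.
by rewrite incidence_dim ?mul0r // dF -subr_eq eq_sym.
Qed.

Lemma layer_dim N i (k : 'I_#|layer N i|) : face_dim (enum_val k) = i.
Proof. by have := enum_valP k; rewrite inE => /andP[_ /eqP]. Qed.

Lemma layer_mem N i (k : 'I_#|layer N i|) : enum_val k \in N.
Proof. by have := enum_valP k; rewrite inE => /andP[]. Qed.

Lemma laplacianE V (D E : simplicial_complex V) i :
  laplacian R D E i =
  family_laplacian (layer (faces D :\: faces E) i) (faces D :\: faces E).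
Proof.
apply/matrixP=> k l; rewrite !mxE; congr (_ + _).
  rewrite -(sum_layer_up _ _ (layer_dim k)) [RHS]big_enum_val.
  by apply: eq_bigr => j _; rewrite !mxE.
rewrite -(sum_layer_down _ _ (layer_dim k)) [RHS]big_enum_val.
by apply: eq_bigr => j _; rewrite !mxE.
Qed.

Variables (Z : nmodType) (g : R -> Z).

Definition spectral_sum N i : Z :=
  \sum_(x <- eigenvalues (family_laplacian (layer N i) N)) g x.

Lemma spectral_sum_layer0 N i : layer N i = set0 -> spectral_sum N i = 0.
Proof.
move=> N0; rewrite /spectral_sum sum_eigenvalues /root_sum.
have -> : char_poly (family_laplacian (layer N i) N) = 1.
  by rewrite N0 /char_poly; move: (char_poly_mx _); rewrite cards0 => A; rewrite det_mx00.
by rewrite -polyC1 rootsRC big_nil.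
Qed.

(** * A complex against the family of its non-faces *)

Section Quotient.
Variables (V : {set T}) (N : {set {set T}}).
Hypotheses (NV : N \subset powerset V)
  (Nclosed : forall F G, F \in N -> G \subset F -> G \in N).
Let M := powerset V :\: N.

Let laplacian_coef_split F G : F \subset V -> G \subset V ->
  laplacian_coef R N F G + laplacian_coef R M F G = #|V|%:R *+ (F == G).
Proof.
move=> FV GV; rewrite -laplacian_coef_simplex // /laplacian_coef addrACA.
by congr (_ + _); rewrite [RHS](big_setID N) (setIidPr NV).
Qed.

(** Closure under subsets leaves a single block [X] of the simplex boundary between [N] and [M]; the
    two Laplacians are what remains of the scalar |V| after removing its Gram matrices. *)
Lemma spectral_sum_quotient i :
  spectral_sum N i + g #|V|%:R *+ #|layer M (i + 1)| =
  spectral_sum M (i + 1) + g #|V|%:R *+ #|layer N i|.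
Proof.
pose X := boundary_mx R (layer N i) (layer M (i + 1)).
have inV F : F \in N -> F \subset V by rewrite -powersetE; apply: subsetP.
have inVM F : F \in M -> F \subset V by rewrite inE powersetE => /andP[].
have sub0 F (a : R) H : F \in N -> H \in M -> incidence R H F * a = 0.
  move=> FN; rewrite inE => /andP[HN _]; rewrite incidence_nsub ?mul0r //.
  by apply: contra HN; apply: Nclosed.
have lapN : family_laplacian (layer N i) N = #|V|%:R%:M - X *m X^T.
  apply/matrixP=> k l; rewrite !mxE.
  have kN := layer_mem k; have lN := layer_mem l.
  (* The index equality in the scalar matrix becomes an equality of faces, as [laplacian_coef_split]
     requires. *)
  apply/eqP; rewrite eq_sym subr_eq -(inj_eq enum_val_inj).
  rewrite -laplacian_coef_split ?inV //; apply/eqP; congr (_ + _).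
  rewrite /laplacian_coef [X in _ + X]big1 ?addr0 => [|H HM]; last exact: sub0.
  rewrite -(sum_layer_up _ _ (layer_dim k)) [LHS]big_enum_val.
  by apply: eq_bigr => j _; rewrite !mxE.
have lapM : family_laplacian (layer M (i + 1)) M = #|V|%:R%:M - X^T *m X.
  apply/matrixP=> k l; rewrite !mxE.
  have kM := layer_mem k; have lM := layer_mem l.
  apply/eqP; rewrite eq_sym subr_eq -(inj_eq enum_val_inj).
  rewrite -laplacian_coef_split ?inVM // [eqbRHS]addrC; apply/eqP; congr (_ + _).
  rewrite /laplacian_coef [X in X + _]big1 ?add0r => [|H HN]; last first.
    by rewrite mulrC sub0.
  rewrite -(sum_layer_down _ _ (layer_dim k)) addrK [LHS]big_enum_val.
  by apply: eq_bigr => j _; rewrite !mxE.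
by rewrite /spectral_sum lapN lapM sum_eigenvalues_gram.
Qed.

End Quotient.

(** * Complementation of faces *)

Section Complement.
Variable V : {set T}.

Definition complements N : {set {set T}} := [set V :\: F | F in N].

(** The exponent adds up the positions in V of the vertices of F. Rescaling the basis by these signs
    makes complementation carry the boundary to its transpose. *)
Let gauge F : R := (-1) ^+ (\sum_(y in F) nb_lower y V).

Let gauge2 F : gauge F * gauge F = 1.
Proof. by rewrite -expr2 -exprM mulnC exprM sqrrN !expr1n. Qed.

Lemma setDDK F : F \subset V -> V :\: (V :\: F) = F.
Proof. by move=> FV; rewrite setDDr setDv set0U (setIidPr FV). Qed.

Lemma face_dimC F : F \subset V -> face_dim (V :\: F) = #|V|%:Z - face_dim F - 2.
Proof.
move=> FV; have := cardsID F V; rewrite (setIidPr FV) /face_dim; lia.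
Qed.

Lemma mem_complements N F :
  N \subset powerset V -> F \subset V -> (V :\: F \in complements N) = (F \in N).
Proof.
move=> NV FV; apply/imsetP/idP=> [[G GN /(congr1 (setD V))]|FN]; last by exists F.
have GV : G \subset V by rewrite -powersetE (subsetP NV).
by rewrite !setDDK // => ->.
Qed.

Lemma layer_complements N i : N \subset powerset V ->
  layer (complements N) i = complements (layer N (#|V|%:Z - i - 2)).
Proof.
move=> NV; apply/setP=> F; rewrite inE; apply/andP/imsetP.
  move=> [/imsetP[G GN ->] dG]; exists G => //; rewrite inE GN /=.
  have GV : G \subset V by rewrite -powersetE (subsetP NV).
  move: dG; rewrite face_dimC // => /eqP <-; apply/eqP; lia.
move=> [G /[!inE] /andP[GN /eqP dG] ->]; split; first by apply/imsetP; exists G.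
have GV : G \subset V by rewrite -powersetE (subsetP NV).
by rewrite face_dimC // dG; apply/eqP; lia.
Qed.

(** If F = H - x, the gauges multiply to (-1)^p with p the position of x in V. As p counts the
    smaller vertices in H plus those in V - F, it accounts for both incidence signs. *)
Lemma incidence_complement F H : F \subset V -> H \subset V ->
  incidence R (V :\: H) (V :\: F) = gauge F * gauge H * incidence R F H.
Proof.
move=> FV HV; rewrite !incidenceE mulr_sumr.
have eqc x : (x \in V :\: F) && ((V :\: F) :\ x == V :\: H) =
             (x \in H) && (H :\ x == F).
  apply/andP/andP=> [[/[!inE] /andP[xF xV] /eqP/setP eqH]|[xH /eqP/setP eqF]].
    have xH : x \in H.
      by have := eqH x; rewrite !inE eqxx xV andbT /=; case: (x \in H).
    split=> //; apply/eqP/setP=> y; have := eqH y; rewrite !inE.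
    case: (eqVneq y x) => [->|_] /=; first by rewrite (negPf xF).
    case yV: (y \in V); first by rewrite !andbT => /(congr1 negb); rewrite !negbK.
    by rewrite (contraFF (subsetP HV y) yV) (contraFF (subsetP FV y) yV).
  split; first by rewrite inE -eqF !inE eqxx (subsetP HV).
  apply/eqP/setP=> y; rewrite !inE -eqF !inE.
  by case: (eqVneq y x) => [->|] //=; rewrite xH.
apply: eq_big => // x; rewrite eqc => /andP[xH /eqP <-].
have xV := subsetP HV x xH.
have -> : gauge H = (-1) ^+ nb_lower x V * gauge (H :\ x).
  by rewrite /gauge (big_setD1 x) //= exprD.
rewrite [gauge _ * (_ * gauge _)]mulrCA gauge2 mulr1 /vertex_sign.
have -> : nb_lower x V = (nb_lower x H + nb_lower x (V :\: (H :\ x)))%N.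
  rewrite {1}/nb_lower (big_setID H) (setIidPr HV); congr (_ + _)%N.
  rewrite setDDr (setIidPr _) ?sub1set // setUC nb_lowerU1 ?ltnn //.
  by rewrite inE xH.
by rewrite -exprD addnAC addnn exprD -mul2n exprM sqrrN !expr1n mul1r.
Qed.

(** Complementation reverses inclusion, so it exchanges the upper and lower sums; the gauge of the
    intermediate face occurs twice and disappears. *)
Lemma laplacian_coef_complement N F G : N \subset powerset V ->
    F \subset V -> G \subset V ->
  laplacian_coef R (complements N) (V :\: F) (V :\: G) =
  gauge F * gauge G * laplacian_coef R N F G.
Proof.
move=> NV FV GV; rewrite /laplacian_coef addrC mulrDr !mulr_sumr.
have inj : {in N &, injective (setD V)}.
  move=> A B /(subsetP NV) AV /(subsetP NV) BV /(congr1 (setD V)).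
  by rewrite !setDDK -?powersetE.
rewrite /complements !(big_imset _ inj) /=.
have reorder (a b h u v : R) : h * h = 1 -> a * h * u * (b * h * v) = a * b * (u * v).
  by move=> hh; rewrite -[RHS]mul1r -hh; ring.
congr (_ + _); apply: eq_bigr => H /(subsetP NV); rewrite powersetE => HV.
  by rewrite !incidence_complement // reorder.
rewrite !incidence_complement // [gauge H * _]mulrC [gauge H * _]mulrC.
exact: reorder.
Qed.

Lemma spectral_sum_complements N i : N \subset powerset V ->
  spectral_sum (complements N) i = spectral_sum N (#|V|%:Z - i - 2).
Proof.
move=> NV; rewrite /spectral_sum !sum_eigenvalues layer_complements //.
set P := layer N _.
have PN : P \subset N by apply/subsetP=> F /[!inE] /andP[].
have PV F : F \in P -> F \subset V.
  by move=> FP; rewrite -powersetE (subsetP NV) // (subsetP PN).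
congr root_sum; symmetry.
have cardC : #|complements P| = #|P|.
  apply: card_in_imset => A B /PV AV /PV BV /(congr1 (setD V)).
  by rewrite !setDDK.
(* The signed permutation matrix of complementation. *)
pose S : 'M[R]_(#|P|, #|complements P|) :=
  \matrix_(k, l) (gauge (enum_val k) *+ (V :\: enum_val k == enum_val l)).
pose inC F (FP : F \in P) : V :\: F \in complements P := imset_f _ FP.
have rankC k : exists l : 'I_#|complements P|, enum_val l = V :\: enum_val (k : 'I_#|P|).
  exists (enum_rank_in (inC _ (enum_valP k)) (V :\: enum_val k)).
  by rewrite enum_rankK_in // inC // enum_valP.
have rankCV (l : 'I_#|complements P|) : exists k : 'I_#|P|, enum_val l = V :\: enum_val k.
  have /imsetP[F FP ->] := enum_valP l.
  by exists (enum_rank_in FP F); rewrite enum_rankK_in.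
(* Each column of [S] has one nonzero entry, in the row of the complementary face. *)
have Sl (k : 'I_#|P|) (l : 'I_#|complements P|) (E : enum_val l = V :\: enum_val k) j :
    S j l = gauge (enum_val k) *+ (j == k).
  rewrite mxE E; case: (eqVneq j k) => [->|jk]; first by rewrite eqxx.
  case: eqP => // /(congr1 (setD V)); rewrite !setDDK ?PV ?enum_valP //.
  by move=> /enum_val_inj jk'; rewrite jk' eqxx in jk.
apply: (char_poly_isometry (S := S)) => //.
  apply/matrixP=> a b; rewrite !mxE.
  have [k Ek] := rankCV a; have [l El] := rankCV b.
  under eq_bigr => j _ do rewrite [S^T _ _]mxE (Sl _ _ Ek) (Sl _ _ El).
  rewrite (bigD1 k) //= big1 ?addr0 => [|j /negPf ->]; last by rewrite mul0r.
  rewrite eqxx mulr1n; have [ab|ab] := eqVneq a b.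
    move: El; rewrite -ab Ek => /(congr1 (setD V)); rewrite !setDDK ?PV ?enum_valP //.
    by move=> /enum_val_inj <-; rewrite eqxx gauge2.
  case: eqVneq => [kl|]; last by rewrite mulr0.
  by rewrite kl -El in Ek; case/eqP: ab; apply: enum_val_inj.
apply/matrixP=> a b; rewrite !mxE.
have [k Ek] := rankC a; have [l El] := rankC b.
rewrite (bigD1 l) //= big1 ?addr0 => [|j jl]; last first.
  rewrite [S^T _ _]mxE; have [m Em] := rankCV j; rewrite (Sl _ _ Em).
  case: eqVneq => [bm|]; last by rewrite mulr0.
  by rewrite -bm -El in Em; case/eqP: jl; apply: enum_val_inj.
rewrite [S^T _ _]mxE (Sl _ _ El) eqxx mulr1n mxE (bigD1 k) //= big1 ?addr0.
  rewrite (Sl _ _ Ek) eqxx mulr1n mxE Ek El laplacian_coef_complement ?PV ?enum_valP //.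
  move: (gauge2 (enum_val a)) (gauge2 (enum_val b)).
  set u := gauge _; set v := gauge _ => uu vv.
  by rewrite -[LHS]mul1r -[LHS]mul1r -{1}uu -vv; ring.
move=> j jk; rewrite mxE; case: eqP => [E|]; last by rewrite mulr0n mul0r.
by rewrite -Ek in E; case/eqP: jk; apply: enum_val_inj.
Qed.

End Complement.
End Families.

(** * The recursion coefficient by coefficient *)

Section Recursion.
Variables (R : realType) (T : finType).
Implicit Types (V : {set T}) (N : {set {set T}}) (F : {set T}).
Implicit Types (e : T) (i : int).

Definition qmon (x : R) : {malg int[qmonom R]} := << insubd (qmonom1 R) x >>.

(** Non-negativity keeps [insubd] away from its default value. *)
Lemma qmonD x y : 0 <= x -> 0 <= y -> qmon (x + y) = qmon x * qmon y.
Proof.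
move=> x0 y0; rewrite /qmon -[_ * _]/(fgmul _ _) fgmulUU mulr1.
congr << _ >>; apply: val_inj.
by rewrite /= !val_insubd !(x0, y0, addr_ge0).
Qed.

Definition qspec : {set {set T}} -> int -> {malg int[qmonom R]} :=
  spectral_sum qmon.

Lemma layer_out_of_range V N i : N \subset powerset V ->
  (i < -1) || (#|V|%:Z <= i) -> layer N i = set0.
Proof.
move=> NV out; apply/eqP; rewrite -subset0; apply/subsetP=> F.
rewrite !inE => /andP[/(subsetP NV)]; rewrite powersetE => /subset_leq_card.
by rewrite /face_dim => FV /eqP dF; lia.
Qed.

Lemma qspec_out_of_range V N i : N \subset powerset V ->
  (i < -1) || (#|V|%:Z <= i) -> qspec N i = 0.
Proof.
by move=> NV out; rewrite /qspec spectral_sum_layer0 ?(layer_out_of_range NV).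
Qed.

Lemma ground_setD V (D E : simplicial_complex V) :
  faces D :\: faces E \subset powerset V.
Proof. exact: subset_trans (subsetDl _ _) (faces_ground D). Qed.

Lemma spectrum_polyE V (D E : simplicial_complex V) :
  spectrum_poly R D E =
  (\poly_(k < #|V|.+1) qspec (faces D :\: faces E) (k%:Z - 1)
    : {poly {malg int[qmonom R]}}).
Proof.
rewrite poly_def; apply: eq_bigr => k _.
rewrite -mul_polyC mulrC; congr (_ * _).
rewrite /qspec /spectral_sum -laplacianE raddf_sum.
by apply: eq_bigr.
Qed.

Lemma coef_spectrum_poly V (D E : simplicial_complex V) (k : nat) :
  (spectrum_poly R D E : {poly {malg int[qmonom R]}})`_k =
  qspec (faces D :\: faces E) (k%:Z - 1).
Proof.
rewrite spectrum_polyE coef_poly; case: ltnP => // k_big.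
by rewrite (qspec_out_of_range (ground_setD D E)) //; lia.
Qed.

(** The coefficient of t^(i+1) in the recursion. Letting i range over all integers makes the index
    set stable under the reflection i -> |V| - i - 3. *)
Definition recursion_in_dim V (D : simplicial_complex V) e i : Prop :=
  qspec (faces D) i =
    qmon 1 * qspec (deletion_faces D e) i
    + qmon 1 * qspec (contraction_faces D e) (i - 1)
    + (1 - qmon 1) * qspec (deletion_faces D e :\: contraction_faces D e) i.

Lemma spectral_recursion_atP V (D : simplicial_complex V) e :
  spectral_recursion_at R D e <-> forall i, recursion_in_dim D e i.
Proof.
pose A := {malg int[qmonom R]}.
pose p V' (D' E' : simplicial_complex V') : {poly A} := spectrum_poly R D' E'.
have -> : spectral_recursion_at R D e <->
    p _ D empty_complex = (qmon 1)%:P * p _ (deletion D e) empty_complex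
      + (qmon 1)%:P * 'X * p _ (contraction D e) empty_complex
      + (1 - (qmon 1)%:P) * p _ (deletion D e) (contraction D e).
  by [].
have coefE (k : nat) :
   ((qmon 1)%:P * p _ (deletion D e) empty_complex
      + (qmon 1)%:P * 'X * p _ (contraction D e) empty_complex
      + (1 - (qmon 1)%:P) * p _ (deletion D e) (contraction D e))`_k =
   qmon 1 * qspec (deletion_faces D e) (k%:Z - 1)
    + qmon 1 * qspec (contraction_faces D e) (k%:Z - 1 - 1)
    + (1 - qmon 1) * qspec (deletion_faces D e :\: contraction_faces D e) (k%:Z - 1).
  rewrite -polyC1 -polyCB -mulrA !coefD !coefCM coefXM !coef_spectrum_poly !setD0.
  (* For k = 0 the factor t gives coefficient 0, in agreement with the absence of faces of dimension
     -2. *)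
  case: k => [|k] /=; last by rewrite (_ : k.+1%:Z - 1 = k%:Z) //; lia.
  rewrite (qspec_out_of_range (contraction_ground D e) (i := 0%:Z - 1 - 1)) //.
split=> [rec i|rec].
  have [i_lo|i_hi] := ltrP i (-1).
    rewrite /recursion_in_dim (qspec_out_of_range (faces_ground D)) ?i_lo //.
    rewrite (qspec_out_of_range (deletion_ground D e)) ?i_lo //.
    rewrite (qspec_out_of_range (contraction_ground D e)); last by apply/orP; lia.
    rewrite (qspec_out_of_range (ground_setD (deletion D e) (contraction D e))) ?i_lo //.
    by rewrite !mulr0 !addr0.
  have [k ->] : exists k : nat, i = k%:Z - 1 by exists (absz (i + 1)); lia.
  by rewrite /recursion_in_dim -coefE -rec coef_spectrum_poly setD0.
by apply/polyP=> k; rewrite coefE coef_spectrum_poly setD0; apply: rec.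
Qed.

(** * The spectrum of the Alexander dual *)

Section DualFaces.
Variables (V : {set T}) (D : simplicial_complex V).

Lemma dual_facesE :
  faces (alexander_dual D) = complements V (powerset V :\: faces D).
Proof.
rewrite (_ : _ :\: _ = [set F in powerset V | F \notin faces D]) //.
by apply/setP=> F; rewrite !inE andbC.
Qed.

Lemma mem_dual F : F \subset V -> (F \in dual_faces D) = (V :\: F \notin faces D).
Proof.
move=> FV; rewrite -[dual_faces D]/(faces (alexander_dual D)) dual_facesE.
rewrite -{1}(setDDK FV) mem_complements ?subsetDl // inE powersetE subsetDl.
by rewrite andbT.
Qed.

(** Complementation moves degree i to degree |V| - i - 2 = j + 1 of the non-faces of D, and the
    quotient relation descends to degree j of D. *)
Lemma qspec_dual i j : j = #|V|%:Z - i - 3 ->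
  qspec (faces (alexander_dual D)) i + qmon #|V|%:R *+ #|layer (faces D) j| =
  qspec (faces D) j + qmon #|V|%:R *+ #|layer (faces (alexander_dual D)) i|.
Proof.
move=> ->; rewrite dual_facesE layer_complements ?subsetDl //.
rewrite /qspec spectral_sum_complements ?subsetDl //.
rewrite (_ : _ - i - 2 = #|V|%:Z - i - 3 + 1); last by lia.
rewrite card_in_imset; last first.
  move=> A B /[!inE] /andP[/andP[_ AV] _] /andP[/andP[_ BV] _].
  by move=> /(congr1 (setD V)); rewrite !setDDK.
by rewrite (spectral_sum_quotient _ (faces_ground D)) //; apply: faces_closed.
Qed.

End DualFaces.

(** Faces avoiding e form the deletion; removing e from the others is injective and lowers the
    dimension by one. *)
Lemma card_layer_deletion_contraction V (D : simplicial_complex V) e i :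
  #|layer (faces D) i| =
  (#|layer (deletion_faces D e) i| + #|layer (contraction_faces D e) (i - 1)|)%N.
Proof.
rewrite -(cardsID [set F : {set T} | e \notin F]); congr (_ + _)%N.
  by apply: eq_card => F; rewrite !inE andbAC.
rewrite -(card_in_imset (f := fun F : {set T} => F :\ e)); last first.
  move=> A B /[!inE] /andP[/negPn eA _] /andP[/negPn eB _] AB.
  by rewrite -(setD1K eA) -(setD1K eB) AB.
apply: eq_card => F; rewrite [RHS]inE; apply/imsetP/andP=> [[G]|].
  rewrite !inE => /andP[/negPn eG /andP[GD /eqP <-]] ->; split.
    by apply/imsetP; exists G; rewrite ?inE ?GD.
  by rewrite /face_dim [X in _ == X%:Z - 1 - 1](cardsD1 e) eG; lia.
move=> [/imsetP[G /[!inE] /andP[GD eG] ->] /eqP dG]; exists G => //.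
rewrite !inE eG GD /=; move: dG; rewrite /face_dim (cardsD1 e G) eG; lia.
Qed.

Lemma eq_family (W : {set T}) (N M : {set {set T}}) :
  N \subset powerset W -> M \subset powerset W ->
  (forall F, F \subset W -> (F \in N) = (F \in M)) -> N = M.
Proof.
move=> NW MW NM; apply/setP=> F; have [/NM //|nFW] := boolP (F \subset W).
have out (P : {set {set T}}) : P \subset powerset W -> (F \in P) = false.
  by move=> PW; apply: contraNF nFW => /(subsetP PW); rewrite powersetE.
by rewrite !out.
Qed.

Lemma mem_contraction V (D : simplicial_complex V) e F : e \notin F ->
  (F \in contraction_faces D e) = (e |: F \in faces D).
Proof.
move=> eF; apply/imsetP/idP=> [[G /[!inE] /andP[GD eG] ->]|FD].
  by rewrite setD1K.
by exists (e |: F); rewrite ?setU1K // !inE FD eqxx.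
Qed.

(** * Duality exchanges deletion and contraction *)

Section DualRecursion.
Variables (V : {set T}) (D : simplicial_complex V) (e : T).
Hypothesis eV : e \in V.

Lemma dual_deletion :
  deletion_faces (alexander_dual D) e = faces (alexander_dual (contraction D e)).
Proof.
apply: (eq_family (deletion_ground _ _) (faces_ground _)) => F FV.
have /andP[FV' eF] : (F \subset V) && (e \notin F) by rewrite -subsetD1.
rewrite inE eF andbT /= !mem_dual // mem_contraction; last by rewrite !inE eqxx andbF.
rewrite (_ : e |: _ = V :\: F) //; apply/setP=> x; rewrite !inE.
by case: (eqVneq x e) => [->|] //=; rewrite eF eV.
Qed.

Lemma dual_contraction :
  contraction_faces (alexander_dual D) e = faces (alexander_dual (deletion D e)).
Proof.
apply: (eq_family (contraction_ground _ _) (faces_ground _)) => F FV.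
have /andP[FV' eF] : (F \subset V) && (e \notin F) by rewrite -subsetD1.
rewrite mem_contraction //= !mem_dual ?subUset ?sub1set ?eV //= inE.
rewrite -setDDl; set G := _ :\: F.
by rewrite (_ : e \notin G) ?andbT // !inE eqxx andbF.
Qed.

(** Dualizing negates membership and swaps the two complexes, so the set difference is merely
    complemented and its spectrum needs no q^n correction. *)
Lemma dual_pair :
  deletion_faces (alexander_dual D) e :\: contraction_faces (alexander_dual D) e =
  complements (V :\ e) (deletion_faces D e :\: contraction_faces D e).
Proof.
have pairW := ground_setD (deletion D e) (contraction D e).
rewrite dual_deletion dual_contraction; apply: (@eq_family (V :\ e)).
- exact: ground_setD.
- by apply/subsetP=> _ /imsetP[F _ ->]; rewrite powersetE subsetDl.
move=> F FV; rewrite -[in RHS](setDDK FV) mem_complements ?subsetDl //.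
by rewrite inE /= !mem_dual //= negbK andbC [RHS]inE andbC.
Qed.

Lemma recursion_in_dim_dual i :
  recursion_in_dim (alexander_dual D) e i <->
  recursion_in_dim D e (#|V|%:Z - i - 3).
Proof.
have cardVn : #|V| = #|V :\ e|.+1 by rewrite (cardsD1 e) eV.
set n := #|V :\ e| in cardVn; have cardV : #|V|%:Z = n%:Z + 1 by lia.
set j := _ - 3.
(* The factor q in front of the deletion and contraction terms makes up for their smaller ground
   set. *)
have qn : qmon #|V|%:R = qmon 1 * qmon n%:R.
  by rewrite -qmonD // cardVn -natr1 addrC.
have fD := qspec_dual D (erefl j).
(* With n = |V| - 1, the reflection on V - e sends i to j - 1 and i - 1 to j, matching the degrees
   of the contraction and the deletion of D. *)
have jdel : j - 1 = n%:Z - i - 3 by rewrite /j cardV; lia.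
have jcon : j = n%:Z - (i - 1) - 3 by rewrite /j cardV; lia.
have fdel := qspec_dual (contraction D e) jdel.
have fcon := qspec_dual (deletion D e) jcon.
rewrite -/n in fdel fcon.
have fpair : qspec (deletion_faces (alexander_dual D) e
      :\: contraction_faces (alexander_dual D) e) i =
    qspec (deletion_faces D e :\: contraction_faces D e) j.
  rewrite dual_pair /qspec spectral_sum_complements.
    by congr spectral_sum; rewrite /j cardV -/n; lia.
  exact: (ground_setD (deletion D e) (contraction D e)).
have nD := card_layer_deletion_contraction D e j.
have nDual := card_layer_deletion_contraction (alexander_dual D) e i.
rewrite /recursion_in_dim fpair dual_deletion dual_contraction.
rewrite nD nDual dual_deletion dual_contraction qn in fD.
(* Here x = q^n, and k, l, k', l' are the face counts: the corrections total (k' + l' - k - l) q x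
   on both sides of the recursion. *)
have shift (A : comNzRingType) (a' a b' b c' c p q x : A) (k l k' l' : nat) :
    a' + (q * x) *+ (k + l) = a + (q * x) *+ (k' + l') ->
    b' + x *+ l = b + x *+ k' -> c' + x *+ k = c + x *+ l' ->
    a' = q * b' + q * c' + (1 - q) * p <-> a = q * c + q * b + (1 - q) * p.
  move=> /(canRL (addrK _)) -> /(canRL (addrK _)) -> /(canRL (addrK _)) ->.
  split=> /eqP; rewrite -subr_eq0 => /eqP eq0; apply/eqP; rewrite -subr_eq0.
    by apply/eqP; rewrite -[RHS]eq0; ring.
  by apply/eqP; rewrite -[RHS]eq0; ring.
exact: shift fD fdel fcon.
Qed.

End DualRecursion.
End Recursion.

Theorem corollary6p8 (R : realType) (T : finType) (V : {set T})
    (D : simplicial_complex V) :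
  spectral_recursion R D <-> spectral_recursion R (alexander_dual D).
Proof.
split=> rec e eV; apply/spectral_recursion_atP => i.
  by apply/(recursion_in_dim_dual R D eV); apply: (spectral_recursion_atP _ _ _).1;
    apply: rec.
(* The reflection is an involution, so every degree of D is reached. *)
have -> : i = #|V|%:Z - (#|V|%:Z - i - 3) - 3 by lia.
by apply/(recursion_in_dim_dual R D eV); apply: (spectral_recursion_atP _ _ _).1;
    apply: rec.
Qed.
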